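(* Let $p$ be an odd prime number, and let $\alpha$ be a positive integer. Then there is an isomorphism of directed graphs $$G^{2}_{\mathbb{Z}_{p^{\alpha}}}\cong G^{2}_{\mathbb{Z}_p}\otimes K^{l}_{p^{\alpha-1}}.$$
   Context: $\mathbb{Z}_n$ is the ring of residue classes modulo $n$, $\mathbb{Z}_n^{\ast}$ its group of units, and $\mathbb{Z}_n^{\ast 2}=\{x^2 : x\in\mathbb{Z}_n^{\ast}\}$. The quadratic unitary Cayley graph $G^{2}_{\mathbb{Z}_n}$ is the directed graph with vertex set $\mathbb{Z}_n$ in which there is an edge from $x$ to $y$ if and only if $y-x\in\mathbb{Z}_n^{\ast 2}$. $K_m^{l}$ denotes the complete graph on $m$ vertices with a loop at each vertex (so its adjacency matrix is the $m\times m$ all-ones matrix). The tensor product $G_1\otimes G_2$ of two graphs has vertex set $V(G_1)\times V(G_2)$, with an edge from $(u,v)$ to $(u',v')$ if and only if there is an edge from $u$ to $u'$ in $G_1$ and an edge from $v$ to $v'$ in $G_2$. *)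

(* Defs.v *)
From HB Require Import structures.
From mathcomp Require Import all_boot all_order all_algebra.
Set Implicit Arguments.
Unset Strict Implicit.
Unset Printing Implicit Defensive.

(* A directed graph (loops allowed) on a finite vertex set T is its edge
   relation e : rel T, with e x y meaning that there is an edge from x to y. *)

Definition unit_squares (n : nat) : {set 'Z_n} :=
  [set (x ^+ 2)%R | x : 'Z_n & x \is a GRing.unit].

(* 'Z_n is the ring of residue classes modulo n only when 1 < n. *)
Definition quadratic_unitary_cayley (n : nat) : rel 'Z_n :=
  fun x y => (y - x)%R \in unit_squares n.

Arguments quadratic_unitary_cayley n : clear implicits.

Definition looped_complete (m : nat) : rel 'I_m := fun _ _ => true.

Arguments looped_complete m : clear implicits.

Definition tensor_product (T1 T2 : finType) (e1 : rel T1) (e2 : rel T2) :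
  rel (T1 * T2) := fun x y => e1 x.1 y.1 && e2 x.2 y.2.

Definition digraph_isomorphic (T1 T2 : finType) (e1 : rel T1) (e2 : rel T2) :
  Prop :=
  exists f : T1 -> T2, bijective f /\ forall x y, e1 x y = e2 (f x) (f y).

(* Main.v *)
(** Write [n = p ^ alpha]. An element [d] of [Z_n] is the square of a unit as
    soon as its residue modulo [p] is: if [d = u ^ 2] modulo [p] then
    [w = d / u ^ 2] lies in [1 + p Z_n], so [w ^ (p ^ (alpha - 1)) = 1], and an
    element of odd order is a square. Adjacency in the graph on [Z_n] thus
    depends only on residues modulo [p], and [x |-> (x mod p, x div p)] is the
    isomorphism. *)
Require Import Defs.
From mathcomp Require Import all_boot all_order all_algebra.

Set Implicit Arguments.
Unset Strict Implicit.
Unset Printing Implicit Defensive.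

Import GRing.Theory.
Local Open Scope ring_scope.

Lemma expr_one_plus_mul (R : comNzRingType) (q c : R) (i : nat) :
  exists d, (1 + q * c) ^+ i = 1 + q * d.
Proof.
elim: i => [|i [d IH]]; first by exists 0; rewrite mulr0 addr0.
exists (c + d + q * c * d); rewrite exprS IH mulrDl mul1r !mulrDr mulr1.
by rewrite -!addrA; congr (_ + _); rewrite addrCA !mulrA (mulrAC q c q).
Qed.

(** Each [p]-th power gains a factor [p]: in [z ^+ p - 1 = (z - 1) * \sum_(i < p) z ^+ i], the sum
    has [p] terms, each congruent to 1 modulo [p]. *)
Lemma expr_natr_one_plus (R : comNzRingType) (p k : nat) (c : R) :
  exists d, (1 + p%:R ^+ k.+1 * c) ^+ p = 1 + p%:R ^+ k.+2 * d.
Proof.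
set z := 1 + _.
have [e Ee] : exists e, \sum_(i < p) z ^+ i = p%:R * e.
  have z_pow i : exists d, z ^+ i = 1 + p%:R * d.
    by rewrite /z exprS -mulrA; apply: expr_one_plus_mul.
  (* The number of terms is freed for the induction; at [m = p] the summand [m%:R] is itself a
     multiple of [p]. *)
  have Esum m : exists d, \sum_(i < m) z ^+ i = m%:R + p%:R * d.
    elim: m => [|m [d IH]]; first by exists 0; rewrite big_ord0 mulr0 addr0.
    have [d' Ed'] := z_pow m; exists (d + d').
    by rewrite big_ord_recr /= IH Ed' addrACA -natr1 mulrDr.
  by have [d ->] := Esum p; exists (1 + d); rewrite mulrDr mulr1.
exists (c * e); apply/eqP; rewrite -subr_eq0 opprD addrA subrX1 Ee subr_eq0.
by rewrite {1}/z addrAC subrr add0r (exprSr _ k.+1) mulrACA.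
Qed.

Lemma expr_prime_power_one_plus (R : comNzRingType) (p k : nat) (c : R) :
  exists d, (1 + p%:R * c) ^+ (p ^ k) = 1 + p%:R ^+ k.+1 * d.
Proof.
elim: k => [|k [d IH]]; first by exists c.
by rewrite expnSr exprM IH; apply: expr_natr_one_plus.
Qed.

(** With [m = 2 * h + 1], the hypothesis gives [w ^+ (2 * h) = w^-1], so [w] is the square of
    [w ^- h]. *)
Lemma unit_square_of_odd_order (R : comUnitRingType) (w : R) (m : nat) :
  odd m -> w ^+ m = 1 -> exists2 v, v \is a GRing.unit & w = v ^+ 2.
Proof.
move=> m_odd wm1; have Em : m = (m./2.*2).+1.
  by rewrite -[LHS]odd_double_half m_odd.
have w_unit : w \is a GRing.unit.
  by rewrite -(@unitrX_pos _ _ m) ?wm1 ?unitr1 // Em.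
exists (w ^- m./2); first by rewrite unitrV unitrX.
rewrite exprVn -exprM muln2; apply: (mulIr (unitrX m./2.*2 w_unit)).
by rewrite mulVr ?unitrX // -exprS -Em.
Qed.

Section ZpReduction.

Variables n p : nat.
Hypotheses (n_gt1 : (1 < n)%N) (p_gt1 : (1 < p)%N) (p_dvd_n : (p %| n)%N).

Definition Zp_reduce (x : 'Z_n) : 'Z_p := (x : nat)%:R.

Lemma val_Zp_reduce (x : 'Z_n) : Zp_reduce x = (x %% p)%N :> nat.
Proof. by rewrite val_Zp_nat. Qed.

Lemma Zp_reduce_nat (m : nat) : Zp_reduce m%:R = m%:R.
Proof.
apply: val_inj; rewrite /= val_Zp_reduce !val_Zp_nat //.
by rewrite modn_dvdm.
Qed.

Lemma Zp_reduceD (x y : 'Z_n) : Zp_reduce (x + y) = Zp_reduce x + Zp_reduce y.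
Proof.
by rewrite -[x in LHS]natr_Zp -[y in LHS]natr_Zp -natrD Zp_reduce_nat natrD.
Qed.

Lemma Zp_reduceM (x y : 'Z_n) : Zp_reduce (x * y) = Zp_reduce x * Zp_reduce y.
Proof.
by rewrite -[x in LHS]natr_Zp -[y in LHS]natr_Zp -natrM Zp_reduce_nat natrM.
Qed.

Lemma Zp_reduceB (x y : 'Z_n) : Zp_reduce (x - y) = Zp_reduce x - Zp_reduce y.
Proof. by apply/eqP; rewrite eq_sym subr_eq -Zp_reduceD subrK. Qed.

Lemma Zp_reduce_eq0 (x : 'Z_n) :
  Zp_reduce x = 0 -> exists c, x = p%:R * c.
Proof.
move/(congr1 val); rewrite /= val_Zp_reduce => /eqP x_dvd.
by exists (x %/ p)%:R; rewrite -natrM mulnC divnK // natr_Zp.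
Qed.

End ZpReduction.

(** On both sides, being a unit means that the representative of [x] is coprime to [p], since
    [p ^ k.+1] and [p] have the same prime divisors. *)
Lemma unit_Zp_reduce (p k : nat) (x : 'Z_(p ^ k.+1)) : (1 < p)%N ->
  (Zp_reduce p x \is a GRing.unit) = (x \is a GRing.unit).
Proof.
move=> p_gt1; have n_gt1 : (1 < p ^ k.+1)%N by rewrite -(expn0 p) ltn_exp2l.
by rewrite -[x in RHS]natr_Zp !unitZpE // coprime_pexpl.
Qed.

Lemma unit_squares_prime_power (p k : nat) (d : 'Z_(p ^ k.+1)) :
  (1 < p)%N -> odd p ->
  (d \in unit_squares (p ^ k.+1)) = (Zp_reduce p d \in unit_squares p).
Proof.
move=> p_gt1 p_odd.
have n_gt1 : (1 < p ^ k.+1)%N by rewrite -(expn0 p) ltn_exp2l.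
have p_dvd : (p %| p ^ k.+1)%N by rewrite dvdn_exp.
apply/imsetP/imsetP => [[x + ->]|[u + Ed]]; rewrite inE => sqrt_unit.
  exists (Zp_reduce p x); first by rewrite inE unit_Zp_reduce.
  by rewrite !expr2 Zp_reduceM.
(* A lift of [u]; it is a unit because its reduction is. *)
pose u' : 'Z_(p ^ k.+1) := (u : nat)%:R.
have Eu : Zp_reduce p u' = u by rewrite Zp_reduce_nat // natr_Zp.
have u'_unit : u' \is a GRing.unit by rewrite -unit_Zp_reduce ?Eu.
have [c Ec] : exists c, d - u' ^+ 2 = p%:R * c.
  apply: Zp_reduce_eq0 => //.
  by rewrite Zp_reduceB // expr2 Zp_reduceM // Eu Ed -expr2 subrr.
have Ew : d / u' ^+ 2 = 1 + p%:R * (c / u' ^+ 2).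
  by rewrite mulrA -Ec mulrBl divrr ?unitrX // addrC subrK.
have [e Ee] := expr_prime_power_one_plus p k (c / u' ^+ 2).
have [] := @unit_square_of_odd_order _ (d / u' ^+ 2) (p ^ k).
- by rewrite oddX p_odd orbT.
(* The error term vanishes because [p ^ k.+1] is zero in ['Z_(p ^ k.+1)]. *)
- by rewrite Ew Ee -natrX pchar_Zp // mul0r addr0.
move=> v v_unit Ev; exists (v * u'); first by rewrite inE unitrM v_unit.
by rewrite exprMn -Ev divrK // unitrX.
Qed.

Local Close Scope ring_scope.

Theorem theorem3p3 (p alpha : nat) (p_prime : prime p) (p_odd : odd p)
    (alpha_gt0 : 0 < alpha) :
  digraph_isomorphic
    (quadratic_unitary_cayley (p ^ alpha))
    (tensor_product (quadratic_unitary_cayley p)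
                    (looped_complete (p ^ (alpha - 1)))).
Proof.
case: alpha alpha_gt0 => // k _; rewrite subn1 /=.
have p_gt1 := prime_gt1 p_prime.
have n_gt1 : 1 < p ^ k.+1 by rewrite -(expn0 p) ltn_exp2l.
have quo_lt (x : 'Z_(p ^ k.+1)) : x %/ p < p ^ k.
  rewrite ltn_divLR ?prime_gt0 // -expnSr.
  (* The carrier of ['Z_n] is an ordinal type whose bound equals [n] only for [1 < n], hence the
     cast. *)
  by rewrite -[X in _ < X](Zp_cast n_gt1) ltn_ord.
exists (fun x => (Zp_reduce p x, Ordinal (quo_lt x))); split.
  (* Euclidean division by [p] recovers [x] from remainder and quotient, and both vertex sets have
     [p * p ^ k] elements. *)
  apply: inj_card_bij => [x y [/(congr1 val) /= Emod Ediv]|].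
    apply: ord_inj; rewrite (divn_eq x p) (divn_eq y p) Ediv.
    by move: Emod; rewrite !val_Zp_reduce // => ->.
  by rewrite card_prod !card_ord !Zp_cast // expnS.
move=> x y; rewrite /tensor_product /looped_complete andbT /=.
rewrite /quadratic_unitary_cayley unit_squares_prime_power //.
by rewrite Zp_reduceB // dvdn_exp.
Qed.
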